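(* For every balanced lattice design $\mathbf{X}\in\mathscr{U}(n,q^s)$, the squared categorical discrepancy is equivalent to the Schur-exponential criterion: $$D^2(\mathbf{X};a\vee b)=\frac{2(1+b)^s\,\Psi_{\mathrm{E}}(\mathbf{X};\rho)}{n^2}+\frac{(1+a)^s}{n}-(1+\mu)^s,$$ where the exponential base is $\rho=(1+a)/(1+b)$. It has the lower bound $$D^2(\mathbf{X};a\vee b)\ \ge\ \frac1n\Big((n-1)(1+b)^s(1-f+\rho f)\rho^{\theta}+(1+a)^s\Big)-(1+\mu)^s.$$
   Context: Let $n,q\ge2$, $s\ge1$ be integers. A lattice design $\mathbf{X}(n,q^s)$ is a collection of $n$ points (runs, repetitions allowed) $\mathbf{x}_1,\dots,\mathbf{x}_n\in\mathcal{L}(q^s)=\{0,1,\dots,q-1\}^s$, written as an $n\times s$ matrix $(x_{ij})$; it is balanced if in each column each of the $q$ levels appears $n/q$ times. $\mathscr{U}(n,q^s)$ is the set of balanced designs. Categorical discrepancy: $a$ is a given constant with $0<a<q-1$, $b\in[-\frac{a}{q-1},a)$, and $\mu=\frac1q(a+(q-1)b)$. Let $\mathcal{S}=\{1,\dots,s\}$. For each nonempty $u\subseteq\mathcal{S}$ and $\mathbf{x},\mathbf{w}\in\mathcal{L}(q^s)$, $$\widehat{\mathbb{K}}_u(\mathbf{x},\mathbf{w})=\prod_{j\in u}\big(b+(a-b)\delta_{x_j,w_j}\big),\qquad D_u(\mathbf{X};\widehat{\mathbb{K}}_u)=\left(-\mu^{|u|}+\frac1{n^2}\sum_{i,k=1}^n\widehat{\mathbb{K}}_u(\mathbf{x}_i,\mathbf{x}_k)\right)^{1/2},$$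 $$D_j(\mathbf{X};a\vee b)=\sqrt{\sum_{|u|=j}D_u^2(\mathbf{X};\widehat{\mathbb{K}}_u)},\qquad D(\mathbf{X};a\vee b)=\sqrt{\sum_{j=1}^sD_j^2(\mathbf{X};a\vee b)}.$$ Schur-exponential criterion: with $m=n(n-1)/2$ and $\beta_1,\dots,\beta_m$ the list of pairwise coincidences $\beta(\mathbf{x}_i,\mathbf{x}_k)=\sum_{j=1}^s\delta_{x_{ij},x_{kj}}$, $1\le i<k\le n$, $\Psi_{\mathrm{E}}(\mathbf{X};\rho)=\sum_{r=1}^m\rho^{\beta_r}$ for $\rho>1$. $\theta$ and $f$ are the integral and fractional parts of $\bar\beta=\frac{s(n-q)}{q(n-1)}$: $\theta=\lfloor\bar\beta\rfloor$, $f=\bar\beta-\theta$. *)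

(* Defs.v *)
From mathcomp Require Import all_boot all_order all_algebra.
From mathcomp Require Import reals.
Set Implicit Arguments.
Unset Strict Implicit.
Unset Printing Implicit Defensive.
Import Order.TTheory GRing.Theory Num.Theory.
Local Open Scope ring_scope.

(* A lattice design X(n, q^s) is a matrix X : 'M['I_q]_(n, s): its run x_i is
   the row vector row i X, and repeated runs are allowed. *)

Definition balanced (n q s : nat) (X : 'M['I_q]_(n, s)) : bool :=
  (q %| n)%N &&
  [forall j : 'I_s, forall l : 'I_q, #|[set i | X i j == l]| == (n %/ q)%N].

Section CategoricalDiscrepancy.

Variables (R : realType) (n q s : nat) (a b : R).

Definition cat_mean : R := q%:R^-1 * (a + (q%:R - 1) * b).

Definition cat_kernel (u : {set 'I_s}) (x w : 'rV['I_q]_s) : R :=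
  \prod_(j in u) (b + (a - b) * (x 0 j == w 0 j)%:R).

Definition proj_discrepancy (X : 'M['I_q]_(n, s)) (u : {set 'I_s}) : R :=
  Num.sqrt (- cat_mean ^+ #|u| +
    (n%:R ^+ 2)^-1 *
      \sum_(i < n) \sum_(k < n) cat_kernel u (row i X) (row k X)).

Definition dim_discrepancy (X : 'M['I_q]_(n, s)) (j : nat) : R :=
  Num.sqrt (\sum_(u : {set 'I_s} | #|u| == j) proj_discrepancy X u ^+ 2).

Definition cat_discrepancy (X : 'M['I_q]_(n, s)) : R :=
  Num.sqrt (\sum_(1 <= j < s.+1) dim_discrepancy X j ^+ 2).

End CategoricalDiscrepancy.

Definition coincidence (q s : nat) (x w : 'rV['I_q]_s) : nat :=
  (\sum_(j < s) (x 0%R j == w 0%R j))%N.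

Definition coincidences (n q s : nat) (X : 'M['I_q]_(n, s)) : seq nat :=
  [seq coincidence (row p.1 X) (row p.2 X)
     | p : 'I_n * 'I_n in [pred p : 'I_n * 'I_n | (p.1 < p.2)%N]].

Definition schur_exp (R : realType) (n q s : nat) (X : 'M['I_q]_(n, s))
    (rho : R) : R :=
  \sum_(beta <- coincidences X) rho ^+ beta.

(* The average of the pairwise coincidences of a balanced design. *)
Definition mean_coincidence (R : realType) (n q s : nat) : R :=
  (s%:R * (n%:R - q%:R)) / (q%:R * (n%:R - 1)).

(* Main.v *)
Require Import Defs.
From mathcomp Require Import all_boot all_order all_algebra.
From mathcomp Require Import reals ring lra.
Set Implicit Arguments.
Unset Strict Implicit.
Unset Printing Implicit Defensive.
Import Order.TTheory GRing.Theory Num.Theory.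
Local Open Scope ring_scope.

(** Write [b + (a - b) delta = mu + (a - b) (delta - 1 / q)].  Since
    [delta - 1 / q] is a Gram kernel, expanding the product over [u] turns the
    double sum of the kernel over the runs into a nonnegative combination of
    squares, one of which is [mu ^ |u| n ^ 2]; so every square root in the
    discrepancy has a nonnegative argument and can be removed.  Summing the
    kernels over all [u] then gives [\prod_j (1 + b + (a - b) delta)
    = (1 + b) ^ s rho ^ beta], whence the identity.  For the lower bound,
    [rho ^ beta >= rho ^ theta (1 + (beta - theta) (rho - 1))] for naturals
    [beta] and [theta] (Bernoulli), and in a balanced design the sum of all
    coincidences depends only on [n], [q] and [s]. *)

(** Off-diagonal terms pair up under the swap of [i] and [k]. Applied below to the kernels, to the
    coincidences and to the constant 1. *)
Lemma sum_symmetric_pairs (R : comNzRingType) (n : nat) (G : 'I_n -> 'I_n -> R) :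
  (forall i k, G i k = G k i) ->
  \sum_i \sum_k G i k =
    \sum_i G i i + 2 * \sum_(p : 'I_n * 'I_n | (p.1 < p.2)%N) G p.1 p.2.
Proof.
move=> Gsym.
rewrite -(pair_big_dep xpredT (fun i k : 'I_n => (i < k)%N) G) /=.
have Gsplit i : \sum_k G i k =
    G i i + (\sum_(k : 'I_n | (i < k)%N) G i k + \sum_(k : 'I_n | (k < i)%N) G i k).
  rewrite (bigD1 i) //= (bigID (fun k : 'I_n => (i < k)%N)) /=.
  congr (_ + (_ + _)); apply: eq_bigl => k; rewrite -(inj_eq val_inj) /=;
    by case: ltngtP.
rewrite (eq_bigr _ (fun i _ => Gsplit i)) !big_split /=; congr (_ + _).
rewrite mulr2n mulrDl mul1r; congr (_ + _).
rewrite (exchange_big_dep xpredT) //=.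
by apply: eq_bigr => i _; apply: eq_bigr => k _; apply: Gsym.
Qed.

(** * Gram expansion of the categorical kernel *)

Lemma sum_indicator (R : nzRingType) (T : finType) (x : T) :
  \sum_l ((x == l)%:R : R) = 1.
Proof.
rewrite (bigD1 x) //= eqxx big1 ?addr0 // => l.
by rewrite eq_sym => /negbTE ->.
Qed.

(** The factors are the coordinates of basis vectors projected orthogonally to the constants, and
    the projection is symmetric and idempotent. *)
Lemma centered_indicator_gram (R : numFieldType) (q : nat) (x w : 'I_q) :
  \sum_(l < q) ((x == l)%:R - q%:R^-1) * ((w == l)%:R - q%:R^-1)
    = (x == w)%:R - q%:R^-1 :> R.
Proof.
have q0 : q%:R != 0 :> R by rewrite pnatr_eq0; case: q x {w} => [[]|].
transitivity (\sum_(l < q) ((x == l)%:R * (w == l)%:R : R)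
   - q%:R^-1 * \sum_(l < q) (x == l)%:R - q%:R^-1 * \sum_(l < q) (w == l)%:R
   + \sum_(l < q) q%:R^-1 ^+ 2).
  rewrite !mulr_sumr -!sumrB -big_split /=.
  by apply: eq_bigr => l _; ring.
rewrite !sum_indicator sumr_const card_ord.
rewrite (bigD1 x) //= eqxx big1 => [|l]; last first.
  by rewrite eq_sym => /negbTE ->; rewrite mul0r.
by rewrite (eq_sym w) mul1r !mulr1; field.
Qed.

Lemma sum_option (R : nmodType) (T : finType) (F : option T -> R) :
  \sum_o F o = F None + \sum_x F (Some x).
Proof.
rewrite (bigD1 None) //=; congr (_ + _).
rewrite (reindex_omap Some id) /=; last by case.
by apply: eq_bigl => x; rewrite eqxx.
Qed.

(* [None] indexes the constant part of the kernel, [Some l] the centered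
   indicators of its Gram part. *)
Lemma cat_kernel_sum_ge (R : realType) (n q s : nat) (a b : R)
    (X : 'M['I_q]_(n, s)) (u : {set 'I_s}) :
  (0 < q)%N -> 0 <= cat_mean q a b -> b <= a ->
  n%:R ^+ 2 * cat_mean q a b ^+ #|u| <=
    \sum_(i < n) \sum_(k < n) cat_kernel a b u (row i X) (row k X).
Proof.
move=> q_gt0 mu_ge0 le_ba.
have q0 : q%:R != 0 :> R by rewrite pnatr_eq0 -lt0n.
pose phi (o : option 'I_q) (x : 'I_q) : R :=
  if o is Some l then (x == l)%:R - q%:R^-1 else 1.
(* Outside [u] the weight keeps only [None], so the factor is 1 and the product can run over all
   columns. *)
pose c (j : 'I_s) (o : option 'I_q) : R :=
  if j \in u then (if o is Some _ then a - b else cat_mean q a b)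
  else (o == None)%:R.
have c_ge0 j o : 0 <= c j o.
  by rewrite /c; case: ifP => _; [case: o => [l|] //; rewrite subr_ge0|].
pose Phi (f : {ffun 'I_s -> option 'I_q}) i := \prod_j phi (f j) (X i j).
have kernelE i k : cat_kernel a b u (row i X) (row k X) =
    \sum_(f : {ffun 'I_s -> option 'I_q})
      (\prod_j c j (f j)) * (Phi f i * Phi f k).
  transitivity (\prod_j \sum_o c j o * (phi o (X i j) * phi o (X k j))).
    rewrite /cat_kernel big_mkcond; apply: eq_bigr => j _.
    rewrite sum_option /c !mxE; case: ifP => ju; last first.
      by rewrite big1 ?addr0 /= ?mul1r // => l _; rewrite mul0r.
    by rewrite -mulr_sumr centered_indicator_gram /cat_mean /=; field.
  rewrite bigA_distr_bigA; apply: eq_bigr => f _.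
  by rewrite !big_split.
have -> : \sum_(i < n) \sum_(k < n) cat_kernel a b u (row i X) (row k X) =
    \sum_(f : {ffun 'I_s -> option 'I_q}) (\prod_j c j (f j)) * (\sum_i Phi f i) ^+ 2.
  transitivity (\sum_(i < n) \sum_(f : {ffun 'I_s -> option 'I_q}) \sum_(k < n)
                  (\prod_j c j (f j)) * (Phi f i * Phi f k)).
    by apply: eq_bigr => i _; rewrite exchange_big /=; apply: eq_bigr.
  rewrite exchange_big; apply: eq_bigr => f _.
  rewrite expr2 mulr_suml mulr_sumr; apply: eq_bigr => i _.
  by rewrite !mulr_sumr.
(* The all-[None] term is exactly the left-hand side; the others are squares with nonnegative
   weights. *)
rewrite (bigD1 [ffun=> None]) //= ler_wpDr //.
  by apply: sumr_ge0 => f _; rewrite mulr_ge0 ?sqr_ge0 ?prodr_ge0.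
rewrite mulrC ler_pM ?exprn_ge0 // le_eqVlt; apply/orP; left; apply/eqP.
  rewrite -prodr_const big_mkcond; apply: eq_bigr => j _.
  by rewrite ffunE /c eqxx.
rewrite (eq_bigr (fun=> 1)) ?sumr_const ?card_ord // => i _.
by rewrite /Phi big1 // => j _; rewrite ffunE.
Qed.

(** * Squared discrepancy as a sum over all column subsets *)

Lemma sum_cat_kernel (R : realType) (q s : nat) (a b : R)
    (x w : 'rV['I_q]_s) :
  1 + b != 0 ->
  \sum_(u : {set 'I_s}) cat_kernel a b u x w =
    (1 + b) ^+ s * ((1 + a) / (1 + b)) ^+ coincidence x w.
Proof.
move=> b0.
transitivity (\prod_j ((b + (a - b) * (x 0 j == w 0 j)%:R) + 1 : R)).
  rewrite bigA_distr; apply: eq_big => [u|u _]; first by rewrite inE.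
  by rewrite /cat_kernel big_mkcond.
rewrite /coincidence expr_sum -[X in _ ^+ X]card_ord -prodr_const -big_split.
by apply: eq_bigr => j _ /=; case: eqP => _ /=; rewrite ?expr0 ?expr1; field.
Qed.

Lemma sum_expr_card (R : comNzRingType) (s : nat) (c : R) :
  \sum_(u : {set 'I_s}) c ^+ #|u| = (1 + c) ^+ s.
Proof.
rewrite addrC -[X in _ ^+ X]card_ord -prodr_const bigA_distr.
apply: eq_big => [u|u _]; first by rewrite inE.
by rewrite -prodr_const big_mkcond.
Qed.

Lemma coincidence_sym (q s : nat) (x w : 'rV['I_q]_s) :
  coincidence x w = coincidence w x.
Proof. by apply: eq_bigr => j _; rewrite eq_sym. Qed.

Lemma coincidence_refl (q s : nat) (x : 'rV['I_q]_s) : coincidence x x = s.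
Proof.
rewrite /coincidence (eq_bigr (fun=> 1%N)) ?sum1_card ?card_ord // => j _.
by rewrite eqxx.
Qed.

Lemma schur_expE (R : realType) (n q s : nat) (X : 'M['I_q]_(n, s)) (rho : R) :
  schur_exp X rho = \sum_(p : 'I_n * 'I_n | (p.1 < p.2)%N)
    rho ^+ coincidence (row p.1 X) (row p.2 X).
Proof. by rewrite /schur_exp /coincidences big_image. Qed.

Lemma sqr_cat_discrepancy (R : realType) (n q s : nat) (a b : R)
    (X : 'M['I_q]_(n, s)) :
  (0 < n)%N -> (0 < q)%N -> 0 <= cat_mean q a b -> b <= a ->
  cat_discrepancy a b X ^+ 2 =
    (n%:R ^+ 2)^-1 * (\sum_(i < n) \sum_(k < n)
       \sum_(u : {set 'I_s}) cat_kernel a b u (row i X) (row k X))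
    - (1 + cat_mean q a b) ^+ s.
Proof.
move=> n_gt0 q_gt0 mu_ge0 le_ba.
have n2_gt0 : 0 < n%:R ^+ 2 :> R by rewrite exprn_gt0 ?ltr0n.
pose E (u : {set 'I_s}) : R := - cat_mean q a b ^+ #|u| + (n%:R ^+ 2)^-1 *
  \sum_(i < n) \sum_(k < n) cat_kernel a b u (row i X) (row k X).
have sqr_proj u : proj_discrepancy a b X u ^+ 2 = E u.
  rewrite sqr_sqrtr // addrC subr_ge0 mulrC ler_pdivlMr // mulrC.
  exact: cat_kernel_sum_ge.
have sqr_dim j :
    dim_discrepancy a b X j ^+ 2 = \sum_(u : {set 'I_s} | #|u| == j) E u.
  rewrite sqr_sqrtr; last by apply: sumr_ge0 => u _; apply: sqr_ge0.
  by apply: eq_bigr => u _; apply: sqr_proj.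
rewrite sqr_sqrtr; last by apply: sumr_ge0 => j _; apply: sqr_ge0.
(* The discrepancy omits the empty set, whose term is 1 - 1; adding it allows the sum over all
   subsets to be factored. *)
have E0 : E set0 = 0.
  rewrite /E cards0 expr0 (eq_bigr (fun=> n%:R)) => [|i _].
    rewrite sumr_const card_ord -[n%:R *+ n]mulr_natl -expr2 mulVf ?gt_eqF //.
    by rewrite addrC subrr.
  rewrite (eq_bigr (fun=> 1)) ?sumr_const ?card_ord // => k _.
  by rewrite /cat_kernel big_set0.
transitivity (\sum_(u : {set 'I_s}) E u).
  transitivity (\sum_(j < s.+1) \sum_(u : {set 'I_s} | #|u| == j) E u).
    rewrite big_ord_recl /= [X in _ = X + _]big1 ?add0r => [|u]; last first.
      by rewrite cards_eq0 => /eqP ->.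
    by rewrite big_add1 big_mkord; apply: eq_bigr => j _; rewrite sqr_dim.
  have card_lt (u : {set 'I_s}) : (#|u| < s.+1)%N.
    by rewrite ltnS -[X in (_ <= X)%N]card_ord max_card.
  rewrite [RHS](partition_big (fun u : {set 'I_s} => inord #|u| : 'I_s.+1) xpredT) //=.
  apply: eq_bigr => j _; apply: eq_bigl => u.
  by rewrite -(inj_eq val_inj) /= inordK.
rewrite big_split /= sumrN sum_expr_card addrC; congr (_ - _).
rewrite -mulr_sumr exchange_big /=; congr (_ * _); apply: eq_bigr => i _.
by rewrite exchange_big.
Qed.

(** * Lower bound on the Schur-exponential criterion *)

(** The left side is the chord of the convex function [rho ^+ c] through [t] and [t + 1], evaluated
    at [c]; no integer lies strictly between these points, so the chord never exceeds the function
    at a natural number. *)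
Lemma expr_tangent_le (R : realDomainType) (rho : R) (t c : nat) :
  0 <= rho -> rho ^+ t * (1 + (c%:R - t%:R) * (rho - 1)) <= rho ^+ c.
Proof.
move=> rho_ge0; elim: t c => [c|t IHt [|c]]; last 1 first.
- rewrite !exprS -mulrA -!natr1 opprD addrACA subrr addr0.
  exact: ler_wpM2l.
- rewrite expr0 mul1r subr0; elim: c => [|c IHc]; first by rewrite mul0r addr0.
  rewrite exprS -natr1 (le_trans _ (ler_wpM2l rho_ge0 IHc)) //.
  rewrite -subr_ge0 (_ : _ - _ = c%:R * (rho - 1) ^+ 2); last by ring.
  by rewrite mulr_ge0 ?sqr_ge0.
(* At [c = 0] the chord value does not increase from [t] to [t + 1]: the drop is
   [rho ^+ t * (t + 1) * (rho - 1) ^+ 2]. *)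
- apply: le_trans (IHt 0%N); rewrite exprSr -mulrA -natr1.
  rewrite ler_wpM2l ?exprn_ge0 // -subr_ge0.
  rewrite (_ : _ - _ = (t%:R + 1) * (rho - 1) ^+ 2); last by ring.
  by rewrite mulr_ge0 ?sqr_ge0 ?addr_ge0.
Qed.

(** In each column a run agrees with exactly [n %/ q] runs, itself included. *)
Lemma sum_coincidence_balanced (n q s : nat) (X : 'M['I_q]_(n, s)) :
  balanced X ->
  (\sum_(i < n) \sum_(k < n) coincidence (row i X) (row k X)
    = s * (n * (n %/ q)))%N.
Proof.
move=> /andP[_ /forallP bal].
rewrite (eq_bigr (fun=> s * (n %/ q)))%N => [|i _].
  by rewrite sum_nat_const card_ord mulnCA.
rewrite exchange_big (eq_bigr (fun=> n %/ q))%N /= => [|j _].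
  by rewrite sum_nat_const card_ord.
have /forallP/(_ (X i j))/eqP <- := bal j.
rewrite -sum1dep_card [RHS]big_mkcond; apply: eq_bigr => k _.
by rewrite !mxE eq_sym; case: eqP.
Qed.

Lemma sum_pair_coincidence (R : realType) (n q s : nat) (X : 'M['I_q]_(n, s)) :
  (2 <= n)%N -> (0 < q)%N -> balanced X ->
  2 * \sum_(p : 'I_n * 'I_n | (p.1 < p.2)%N)
    (coincidence (row p.1 X) (row p.2 X))%:R
    = n%:R * (n%:R - 1) * mean_coincidence R n q s.
Proof.
(* Divisibility makes the truncated quotient [n %/ q] exact; the diagonal contributes [n * s], to be
   subtracted. *)
move=> n_ge2 q_gt0 bal; have /andP[/divnK dvd_qn _] := bal.
have := sum_coincidence_balanced bal => /(congr1 (fun m : nat => m%:R : R)).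
rewrite natr_sum (eq_bigr (fun i => \sum_(k < n)
  (coincidence (row i X) (row k X))%:R)) => [|i _]; last by rewrite natr_sum.
rewrite (sum_symmetric_pairs (G := fun i k =>
  (coincidence (row i X) (row k X))%:R)) => [|i k]; last first.
  by rewrite coincidence_sym.
rewrite (eq_bigr (fun=> s%:R)) => [|i _]; last by rewrite coincidence_refl.
rewrite sumr_const card_ord -mulr_natr => /(canRL (addKr _)) ->.
have q0 : q%:R != 0 :> R by rewrite pnatr_eq0 -lt0n.
have n1 : n%:R - 1 != 0 :> R.
  by rewrite subr_eq0 pnatr_eq1 gtn_eqF.
rewrite /mean_coincidence !natrM.
rewrite -[X in X%:R - q%:R]dvd_qn natrM -[n in (n %/ q)%N]dvd_qn mulnK //.
by field; rewrite n1 q0.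
Qed.

Lemma card_ltn_pairs (R : comNzRingType) (n : nat) :
  2 * \sum_(p : 'I_n * 'I_n | (p.1 < p.2)%N) 1 = n%:R * (n%:R - 1) :> R.
Proof.
have := sum_symmetric_pairs (R := R) (n := n) (G := fun _ _ => 1) (fun _ _ => erefl).
rewrite (eq_bigr (fun=> n%:R)) => [|i _]; last by rewrite sumr_const card_ord.
rewrite [LHS]sumr_const [X in X + _]sumr_const !card_ord -[n%:R *+ n]mulr_natr.
move=> /esym/(canRL (addKr _)) ->.
by ring.
Qed.

(** The chord bound is affine in the coincidence, so its sum over pairs involves only their number
    and the total coincidence. Any natural [t] is allowed. *)
Lemma schur_exp_ge (R : realType) (n q s : nat) (X : 'M['I_q]_(n, s))
    (rho : R) (t : nat) :
  (2 <= n)%N -> (0 < q)%N -> balanced X -> 0 <= rho ->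
  n%:R * (n%:R - 1) *
    (rho ^+ t * (1 + (mean_coincidence R n q s - t%:R) * (rho - 1)))
    <= 2 * schur_exp X rho.
Proof.
move=> n_ge2 q_gt0 bal rho_ge0.
have tangent : \sum_(p : 'I_n * 'I_n | (p.1 < p.2)%N) (rho ^+ t *
    (1 + ((coincidence (row p.1 X) (row p.2 X))%:R - t%:R) * (rho - 1)))
    <= schur_exp X rho.
  rewrite schur_expE; apply: ler_sum => p _; exact: expr_tangent_le.
apply: le_trans (ler_wpM2l (ler0n R 2) tangent).
rewrite le_eqVlt; apply/orP; left; apply/eqP.
transitivity (rho ^+ t * (rho - 1) *
    (2 * \sum_(p : 'I_n * 'I_n | (p.1 < p.2)%N)
      (coincidence (row p.1 X) (row p.2 X))%:R)
  + rho ^+ t * (1 - t%:R * (rho - 1)) *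
    (2 * \sum_(p : 'I_n * 'I_n | (p.1 < p.2)%N) 1)).
  by rewrite card_ltn_pairs (sum_pair_coincidence R) //; ring.
rewrite !mulr_sumr -big_split /=; apply: eq_bigr => p _; ring.
Qed.

Theorem theorem5 (R : realType) (n q s : nat) (a b : R)
    (hn : (2 <= n)%N) (hq : (2 <= q)%N) (hs : (1 <= s)%N)
    (ha0 : 0 < a) (haq : a < q%:R - 1)
    (hb : - (a / (q%:R - 1)) <= b) (hba : b < a)
    (X : 'M['I_q]_(n, s)) (hX : balanced X) :
  let mu := cat_mean q a b in
  let rho := (1 + a) / (1 + b) in
  let betabar := mean_coincidence R n q s in
  let theta : int := Num.floor betabar in
  let f := betabar - theta%:~R in
  cat_discrepancy a b X ^+ 2 =
      2 * (1 + b) ^+ s * schur_exp X rho / n%:R ^+ 2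
      + (1 + a) ^+ s / n%:R - (1 + mu) ^+ s
  /\
  cat_discrepancy a b X ^+ 2 >=
      n%:R^-1 * ((n%:R - 1) * (1 + b) ^+ s * (1 - f + rho * f) * rho ^ theta
                 + (1 + a) ^+ s)
      - (1 + mu) ^+ s.
Proof.
move=> mu rho betabar theta f.
have n_gt0 : (0 < n)%N by exact: ltnW.
have q_gt0 : (0 < q)%N by exact: ltnW.
have n0 : n%:R != 0 :> R by rewrite pnatr_eq0 -lt0n.
have q1_gt0 : 0 < q%:R - 1 :> R by rewrite subr_gt0 ltr1n.
have b1_gt0 : 0 < 1 + b.
  have : a / (q%:R - 1) < 1 by rewrite ltr_pdivrMr ?mul1r.
  by move: hb; lra.
(* The lower bound on [b] says precisely that [q * mu = a + (q - 1) * b] is nonnegative. *)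
have mu_ge0 : 0 <= mu.
  move: hb; rewrite -mulNr ler_pdivrMr // => hb'.
  by rewrite mulr_ge0 ?invr_ge0 // mulrC; lra.
have rho_ge0 : 0 <= rho by rewrite divr_ge0 //; lra.
have DE : cat_discrepancy a b X ^+ 2 =
      2 * (1 + b) ^+ s * schur_exp X rho / n%:R ^+ 2
      + (1 + a) ^+ s / n%:R - (1 + mu) ^+ s.
  rewrite (sqr_cat_discrepancy X n_gt0 q_gt0 mu_ge0 (ltW hba)); congr (_ - _).
  rewrite (sum_symmetric_pairs (G := fun i k => \sum_(u : {set 'I_s})
    cat_kernel a b u (row i X) (row k X))) => [|i k]; last first.
    by rewrite !sum_cat_kernel ?gt_eqF // coincidence_sym.
  (* A run has coincidence [s] with itself, and [(1 + b) * rho = 1 + a]. *)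
  rewrite (eq_bigr (fun=> (1 + a) ^+ s)) => [|i _]; last first.
    rewrite sum_cat_kernel ?gt_eqF // coincidence_refl -exprMn.
    by rewrite mulrC divfK ?gt_eqF.
  rewrite sumr_const card_ord -mulr_natr.
  rewrite (eq_bigr _ (fun p _ => sum_cat_kernel a _ _ (lt0r_neq0 b1_gt0))).
  rewrite -mulr_sumr -schur_expE -/rho.
  by field.
split=> //; rewrite DE lerB //.
(* Since [q <= n], the mean coincidence is nonnegative; hence [theta] is a natural number and can
   serve as the [t] of the chord bound. *)
have le_qn : (q <= n)%N by apply: dvdn_leq => //; case/andP: hX.
have betabar_ge0 : 0 <= betabar.
  by rewrite divr_ge0 // mulr_ge0 // subr_ge0 ?ler_nat ?ler1n.
have : 0 <= theta by rewrite floor_ge0.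
rewrite {}/f; case: theta => // t _; rewrite -exprnP -pmulrn.
have := schur_exp_ge t hn q_gt0 hX rho_ge0; rewrite -/betabar => le_schur.
(* Scaled by this factor, the bound on the criterion has the same difference of sides as the goal,
   because [1 - f + rho * f = 1 + f * (rho - 1)]. *)
have c_ge0 : 0 <= (1 + b) ^+ s / n%:R ^+ 2 by rewrite divr_ge0 ?exprn_ge0 // ltW.
have := ler_wpM2l c_ge0 le_schur; rewrite -subr_ge0 => le_schur'.
rewrite -subr_ge0; apply: le_trans le_schur' _.
rewrite le_eqVlt; apply/orP; left; apply/eqP.
by field.
Qed.
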